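(* Let $A\in\mathbb{R}^{m\times d}$ have full rank and let $b\in\mathbb{R}^m$. Consider the system $A\theta=b$ in the unknown $\theta\in\mathbb{R}^d$. Then solving this system in the column space (range) of $A$, or in the row space (kernel) of $A$, is equivalent to minimizing the squared error $\|A\theta-b\|_2^2$. That is: (a) if $\operatorname{rank}A=d$, then $\theta\in\mathbb{R}^d$ solves the system in the column space of $A$ if and only if $\theta$ minimizes $\|A\theta-b\|_2^2$ over $\mathbb{R}^d$; (b) if $\operatorname{rank}A=m$, then an element $\theta$ of the row space $\{A^Ts: s\in\mathbb{R}^m\}$ solves the system in the row space of $A$ if and only if it minimizes $\|A\theta-b\|_2^2$. Moreover, in each case the resultant solution $\hat\theta$ is unique, and it has minimum norm in the sense that $\|\hat\theta\|_2^2\le\|\theta\|_2^2$ for all feasible $\theta$.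
   Context: Solving $A\theta=b$ in the column space (range) of $A$ (the primal space, for $\operatorname{rank}A=d$) means solving the equation $A^TA\theta=A^Tb$ obtained by pre-multiplying by $A^T$; its solution is $\hat\theta=(A^TA)^{-1}A^Tb$. Solving $A\theta=b$ in the row space of $A$ (the dual space, for $\operatorname{rank}A=m$; the paper also calls this ''the kernel'') means setting $\theta=A^Ts$ with $s\in\mathbb{R}^m$ and solving $AA^Ts=b$; the resulting solution is $\hat\theta=A^T(AA^T)^{-1}b$. A vector $\theta\in\mathbb{R}^d$ is called feasible if it minimizes $\|A\theta-b\|_2^2$ over $\mathbb{R}^d$ (when $\operatorname{rank}A=m$, this means $A\theta=b$). *)

(* Defs.v *)
From HB Require Import structures.
From mathcomp Require Import all_boot all_order all_algebra.
From mathcomp Require Import reals.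

Set Implicit Arguments.
Unset Strict Implicit.
Unset Printing Implicit Defensive.

Import Order.TTheory GRing.Theory Num.Theory.
Local Open Scope ring_scope.

(* The squared Euclidean norm; MathComp-Analysis's `|v| on matrices is the
   sup norm. *)
Definition sqnorm2 (R : realType) (n : nat) (v : 'cV[R]_n) : R :=
  \sum_(i < n) v i 0 ^+ 2.

Definition feasible (R : realType) (m d : nat) (A : 'M[R]_(m, d))
    (b : 'cV[R]_m) (theta : 'cV[R]_d) : Prop :=
  forall eta : 'cV[R]_d,
    sqnorm2 (A *m theta - b) <= sqnorm2 (A *m eta - b).

Definition solves_column_space (R : realType) (m d : nat) (A : 'M[R]_(m, d))
    (b : 'cV[R]_m) (theta : 'cV[R]_d) : Prop :=
  A^T *m A *m theta = A^T *m b.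

Definition in_row_space (R : realType) (m d : nat) (A : 'M[R]_(m, d))
    (theta : 'cV[R]_d) : Prop :=
  exists s : 'cV[R]_m, theta = A^T *m s.

Definition solves_row_space (R : realType) (m d : nat) (A : 'M[R]_(m, d))
    (b : 'cV[R]_m) (theta : 'cV[R]_d) : Prop :=
  exists s : 'cV[R]_m, theta = A^T *m s /\ A *m A^T *m s = b.

(* invmx is the identity on singular matrices, so the next two formulas are
   meaningful only together with the invertibility of the Gram matrix. *)
Definition column_space_solution (R : realType) (m d : nat)
    (A : 'M[R]_(m, d)) (b : 'cV[R]_m) : 'cV[R]_d :=
  invmx (A^T *m A) *m A^T *m b.

Definition row_space_solution (R : realType) (m d : nat)
    (A : 'M[R]_(m, d)) (b : 'cV[R]_m) : 'cV[R]_d :=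
  A^T *m invmx (A *m A^T) *m b.

(* Main.v *)
(* Expanding the square along a perturbation of theta shows that theta is
   feasible iff the residual A theta - b is orthogonal to the range of A, i.e.
   iff the normal equations hold.  A Gram matrix of linearly independent vectors
   is invertible, so for rank d there is only one feasible point, and for rank m
   the feasible points are the solutions of A theta = b; the one in the row space
   is orthogonal to the kernel of A, hence the shortest by Pythagoras. *)
Require Import Defs.
From HB Require Import structures.
From mathcomp Require Import all_boot all_order all_algebra.
From mathcomp Require Import reals.
From mathcomp Require Import ring lra.

Import Order.TTheory GRing.Theory Num.Theory.
Local Open Scope ring_scope.

Lemma sqnorm2E (R : realType) (n : nat) (v : 'cV[R]_n) :
  sqnorm2 v = (v^T *m v) 0 0.
Proof. by rewrite mxE; apply: eq_bigr => i _; rewrite !mxE expr2. Qed.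

Lemma sqnorm2_ge0 (R : realType) (n : nat) (v : 'cV[R]_n) : 0 <= sqnorm2 v.
Proof. by apply: sumr_ge0 => i _; exact: sqr_ge0. Qed.

Lemma sqnorm2_eq0 (R : realType) (n : nat) (v : 'cV[R]_n) :
  sqnorm2 v = 0 -> v = 0.
Proof.
move=> /eqP; rewrite psumr_eq0 => [/allP v0|i _]; last exact: sqr_ge0.
apply/colP => i; rewrite mxE; apply/eqP.
by rewrite -sqrf_eq0; apply: v0; rewrite mem_index_enum.
Qed.

Lemma sqnorm2D (R : realType) (n : nat) (u v : 'cV[R]_n) :
  sqnorm2 (u + v) = sqnorm2 u + (v^T *m u) 0 0 *+ 2 + sqnorm2 v.
Proof.
rewrite /sqnorm2 mxE -sumrMnl -!big_split /=; apply: eq_bigr => i _.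
by rewrite !mxE; ring.
Qed.

Lemma sqnorm2Z (R : realType) (n : nat) (a : R) (v : 'cV[R]_n) :
  sqnorm2 (a *: v) = a ^+ 2 * sqnorm2 v.
Proof.
by rewrite /sqnorm2 mulr_sumr; apply: eq_bigr => i _; rewrite mxE exprMn.
Qed.

(** Twice [A^T *m (A *m theta - b)] is the gradient of the squared error, so the middle term is the
    first-order change along [h]. *)
Lemma residual_perturb (R : realType) (m d : nat) (A : 'M[R]_(m, d))
    (b : 'cV[R]_m) (theta h : 'cV[R]_d) :
  sqnorm2 (A *m (theta + h) - b) =
  sqnorm2 (A *m theta - b) + (h^T *m (A^T *m (A *m theta - b))) 0 0 *+ 2
    + sqnorm2 (A *m h).
Proof. by rewrite (mulmxDr A) (addrAC _ _ (- b)) sqnorm2D trmx_mul mulmxA. Qed.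

Lemma feasibleP (R : realType) (m d : nat) (A : 'M[R]_(m, d)) (b : 'cV[R]_m)
    (theta : 'cV[R]_d) :
  feasible A b theta <-> A^T *m (A *m theta - b) = 0.
Proof.
split=> [fth|neq eta]; last first.
  rewrite -[eta](subrK theta) (addrC _ theta) residual_perturb neq.
  by rewrite mulmx0 mxE mul0rn addr0 lerDl sqnorm2_ge0.
set g := A^T *m _; apply: sqnorm2_eq0.
set p := sqnorm2 g; set q := sqnorm2 (A *m g).
have q0 : 0 <= q := sqnorm2_ge0 _ _ (A *m g).
(* Move against the gradient, [h = - t g]: the cross term becomes [-2 t p], and feasibility bounds
   the total change below by 0. *)
have step t : 0 <= t ^+ 2 * q - t * p *+ 2.
  have := fth (theta + - t *: g).
  rewrite residual_perturb -/g linearZ /= -scalemxAl -scalemxAr sqnorm2Z mxE.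
  by rewrite -sqnorm2E -/p -/q sqrrN; lra.
have q1 : 0 < q + 1 by lra.
(* t = p/q minimizes the quadratic; q + 1 replaces q, which may be zero. *)
have := step (p / (q + 1)).
have -> : (p / (q + 1)) ^+ 2 * q - p / (q + 1) * p *+ 2 =
    - (p ^+ 2 * ((q + 2) / (q + 1) ^+ 2)) by field; lra.
(* The factor multiplying [p ^+ 2] is positive, so [p ^+ 2 <= 0]. *)
rewrite oppr_ge0 pmulr_lle0; last by rewrite divr_gt0 ?exprn_gt0 //; lra.
by move=> p2; apply/eqP; rewrite -sqrf_eq0 eq_le p2 sqr_ge0.
Qed.

Lemma feasible_normal (R : realType) (m d : nat) (A : 'M[R]_(m, d))
    (b : 'cV[R]_m) (theta : 'cV[R]_d) :
  feasible A b theta <-> solves_column_space A b theta.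
Proof.
rewrite feasibleP /solves_column_space mulmxBr mulmxA.
by split=> [/subr0_eq|->]; rewrite ?subrr.
Qed.

(** If [v A A^T = 0], then [v A A^T v^T], the squared norm of [v A], is 0; hence [v A = 0], and
    [v = 0] by independence of the rows. *)
Lemma row_free_gram_unitmx (R : realType) (m d : nat) (A : 'M[R]_(m, d)) :
  row_free A -> A *m A^T \in unitmx.
Proof.
move=> Afree; rewrite -row_free_unit; apply: inj_row_free => v vAA0.
apply: (row_free_inj Afree); rewrite mul0mx; apply: trmx_inj; rewrite trmx0.
apply: sqnorm2_eq0.
by rewrite sqnorm2E trmxK trmx_mul mulmxA -(mulmxA v) vAA0 mul0mx mxE.
Qed.

(** Applying [A] to the normal equations gives [A A^T (A theta - b) = 0], and the invertible Gram
    matrix cancels. *)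
Lemma row_free_feasible (R : realType) (m d : nat) (A : 'M[R]_(m, d))
    (b : 'cV[R]_m) (theta : 'cV[R]_d) :
  row_free A -> (feasible A b theta <-> A *m theta = b).
Proof.
move=> /row_free_gram_unitmx AAu; rewrite feasibleP.
split=> [Ar0|->]; last by rewrite subrr mulmx0.
by apply: subr0_eq; rewrite -(mulKmx AAu (_ - b)) -(mulmxA A) Ar0 !mulmx0.
Qed.

Theorem lemma1 (R : realType) (m d : nat) (A : 'M[R]_(m, d)) (b : 'cV[R]_m)
    (A_full_rank : \rank A = minn m d) :
  (\rank A = d ->
    [/\ forall theta : 'cV[R]_d,
          solves_column_space A b theta <-> feasible A b theta,
        A^T *m A \in unitmx,
        unique (solves_column_space A b) (column_space_solution A b)
      & forall theta : 'cV[R]_d, feasible A b theta ->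
          sqnorm2 (column_space_solution A b) <= sqnorm2 theta])
  /\
  (\rank A = m ->
    [/\ forall theta : 'cV[R]_d, in_row_space A theta ->
          (solves_row_space A b theta <-> feasible A b theta),
        A *m A^T \in unitmx,
        unique (solves_row_space A b) (row_space_solution A b)
      & forall theta : 'cV[R]_d, feasible A b theta ->
          sqnorm2 (row_space_solution A b) <= sqnorm2 theta]).
Proof.
split=> [rkd|rkm].
  (* Rank [d] makes [A^T] row free, and this is its Gram matrix. *)
  have AAu : A^T *m A \in unitmx.
    by rewrite -{2}[A]trmxK row_free_gram_unitmx // /row_free mxrank_tr rkd.
  have uniq_sol theta :
      solves_column_space A b theta -> column_space_solution A b = theta.
    by move=> sol; rewrite /column_space_solution -mulmxA -sol mulKmx.
  split=> //.
  - by move=> theta; split=> /feasible_normal.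
  - split=> //; rewrite /solves_column_space /column_space_solution.
    by rewrite -(mulmxA (invmx _)) mulKVmx.
  (* The only feasible point is the solution itself, so the bound is an equality. *)
  - by move=> theta /feasible_normal /uniq_sol ->.
have Afree : row_free A by rewrite /row_free rkm.
have AAu := row_free_gram_unitmx _ _ _ _ Afree.
have hatE : row_space_solution A b = A^T *m (invmx (A *m A^T) *m b).
  by rewrite /row_space_solution mulmxA.
split=> //.
- move=> theta [s ths]; rewrite row_free_feasible //; split=> [[s' [-> <-]]|<-].
    by rewrite mulmxA.
  by exists s; rewrite {2}ths mulmxA.
- split=> [|theta [s [-> <-]]].
    by exists (invmx (A *m A^T) *m b); rewrite -hatE mulKVmx.
  by rewrite /row_space_solution -mulmxA mulKmx.
- move=> theta; rewrite row_free_feasible // => Ath.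
  have Ahat : A *m row_space_solution A b = b by rewrite hatE mulmxA mulKVmx.
  (* Both points solve the system, so their difference lies in the kernel of [A], orthogonal to the
     range of [A^T]. *)
  have orth : (theta - row_space_solution A b)^T *m row_space_solution A b = 0.
    by rewrite [X in _ *m X]hatE mulmxA -trmx_mul mulmxBr Ath Ahat subrr trmx0 mul0mx.
  rewrite -[theta](subrK (row_space_solution A b)) (addrC (_ - _)) sqnorm2D orth.
  by rewrite mxE mul0rn addr0 lerDl sqnorm2_ge0.
Qed.
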